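(* Let $\alpha>1/2$ and let $\mathcal{B}_{\alpha}=\{\boldsymbol{\beta}=(\beta_1,\beta_2,\ldots): |\beta_i|\le i^{-\alpha}\text{ for all } i\ge 1\}$. Suppose that $\boldsymbol{\beta}\in\mathcal{B}_\alpha$ and that one observes $X_i=\beta_i+n^{-1/2}\varepsilon_i$, $i=1,2,\ldots$, with $\varepsilon_i$ i.i.d. $N(0,1)$. Then: (1) for any $g=(g_1,g_2,\ldots)\in\ell_2$, the estimator $\widehat{\theta}=\sum_{i=1}^\infty g_iX_i$ of $\theta=\sum_{i=1}^\infty g_i\beta_i$ is $\sqrt{n}$-consistent; and (2) the estimator $\widehat{\boldsymbol{\beta}}=(\widehat\beta_1,\widehat\beta_2,\ldots)$ of $\boldsymbol{\beta}$ defined by $$\widehat\beta_i=\begin{cases}X_i, & i^{\alpha}\le n^{1/2},\\ 0,& i^{\alpha}>n^{1/2},\end{cases}$$ achieves the minimax rate of convergence over $\mathcal{B}_\alpha$ under the loss $\|\widehat{\boldsymbol\beta}-\boldsymbol\beta\|_2^2$, which is $n^{-(2\alpha-1)/2\alpha}$.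
   Context: White noise model in sequence form: the entire infinite sequence $X_1,X_2,\ldots$ is observed and $n$ serves only as a scaling parameter; asymptotics are as $n\to\infty$. The vector $\boldsymbol{\beta}$ is estimated as an object in $\ell_2$ with loss $\|\widehat{\boldsymbol\beta}-\boldsymbol\beta\|_2^2=\sum_i(\widehat\beta_i-\beta_i)^2$; the minimax rate is the order of magnitude in $n$ of $\inf_{\tilde{\boldsymbol\beta}}\sup_{\boldsymbol\beta\in\mathcal{B}_\alpha}\mathsf{E}_{\boldsymbol\beta}\|\tilde{\boldsymbol\beta}-\boldsymbol\beta\|_2^2$, and an estimator achieves it if its supremum risk over $\mathcal{B}_\alpha$ is of that order. An estimator $\widehat\theta$ of a real parameter $\theta$ is $\sqrt{n}$-consistent if $\sqrt{n}(\widehat\theta-\theta)=O_P(1)$. The exponent $-(2\alpha-1)/2\alpha$ means $-(2\alpha-1)/(2\alpha)$. *)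

(* Defs.v *)
From HB Require Import structures.
From mathcomp Require Import all_boot all_order all_algebra finmap.
From mathcomp Require Import all_classical all_reals all_analysis.

Set Implicit Arguments.
Unset Strict Implicit.
Unset Printing Implicit Defensive.

Import Order.TTheory GRing.Theory Num.Theory.
Import numFieldNormedType.Exports.

Local Open Scope classical_set_scope.
Local Open Scope ring_scope.

(* Sequences are indexed by nat from 0: the entry x i stands for x_{i+1}. *)

(* The space R^N of real sequences with the product sigma-algebra. *)
Definition cylinders (R : realType) : set (set (nat -> R)) :=
  \bigcup_(i in [set: nat])
    preimage_set_system [set: nat -> R] (fun x : nat -> R => x i) measurable.
Arguments cylinders R : clear implicits.

Definition seq_space (R : realType) := g_sigma_algebraType (cylinders R).
Arguments seq_space R : clear implicits.

Section SequenceSpace.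
Variable R : realType.
Implicit Types (g beta x : nat -> R) (alpha : R).

Definition sq_norm x : \bar R := (\sum_(0 <= i <oo) ((x i) ^+ 2)%:E)%E.

Definition ell2 x : Prop := (sq_norm x < +oo)%E.

Definition B_alpha alpha : set (nat -> R) :=
  [set beta | forall i, `|beta i| <= i.+1%:R `^ (- alpha)].

(* The sum of the g_i x_i; limn takes an arbitrary value if the series
   diverges. *)
Definition linear_form g x : R := limn (series (fun i => g i * x i)).

Definition beta_hat alpha (n : nat) (x : seq_space R) : seq_space R :=
  fun i => if i.+1%:R `^ alpha <= Num.sqrt n%:R then x i else 0.

(* On the separable space l_2, the Borel sigma-algebra is the trace of the
   product sigma-algebra, so coordinatewise measurability is what makes b a
   random element of l_2. *)
Definition estimator (b : seq_space R -> seq_space R) : Prop :=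
  measurable_fun [set: seq_space R] b /\ (forall x, ell2 (b x)).

End SequenceSpace.

Section Model.
Context (R : realType) (d : measure_display) (T : measurableType d).
Variable P : probability T R.
Implicit Types (eps : nat -> {RV P >-> R}) (beta : nat -> R).

Definition mutually_independent eps : Prop :=
  forall (J : {fset nat}) (A : nat -> set R), (forall i, measurable (A i)) ->
    P (\bigcap_(i in [set` J]) (eps i @^-1` A i)) =
    (\prod_(i <- J) P (eps i @^-1` A i))%E.

Definition iid_std_normal eps : Prop :=
  mutually_independent eps /\
  (forall i (A : set R), measurable A ->
     distribution P (eps i) A = normal_prob 0 1 A).

Definition observation eps (n : nat) beta (w : T) : seq_space R :=
  fun i => beta i + (Num.sqrt n%:R)^-1 * eps i w.

Definition bounded_in_probability (Z : nat -> T -> R) : Prop :=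
  forall delta : R, 0 < delta -> exists2 M : R, 0 < M &
    \forall n \near \oo, (P [set w | (M < `|Z n w|)%R] <= delta%:E)%E.

Definition sqrtn_consistent (theta_hat : nat -> T -> R) (theta : R) : Prop :=
  bounded_in_probability
    (fun n w => Num.sqrt n%:R * (theta_hat n w - theta)).

Definition risk eps (n : nat) (b : seq_space R -> seq_space R) beta : \bar R :=
  (\int[P]_w sq_norm (fun i => (b (observation eps n beta w) i - beta i)%R))%E.

Definition max_risk eps (alpha : R) (n : nat)
    (b : seq_space R -> seq_space R) : \bar R :=
  ereal_sup [set risk eps n b beta | beta in B_alpha alpha].

Definition minimax_risk eps (alpha : R) (n : nat) : \bar R :=
  ereal_inf [set max_risk eps alpha n b | b in @estimator R].

End Model.

Definition same_order (R : realType) (a : nat -> \bar R) (r : nat -> R) : Prop :=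
  exists c C : R, [/\ 0 < c, 0 < C &
    \forall n \near \oo, ((c * r n)%:E <= a n)%E /\ (a n <= (C * r n)%:E)%E].

(* Main.v *)
Require Import Defs.
From HB Require Import structures.
From mathcomp Require Import all_boot all_order all_algebra finmap.
From mathcomp Require Import all_classical all_reals all_analysis.
From mathcomp Require Import measurable_realfun.
From mathcomp Require Import ring lra.

Set Implicit Arguments.
Unset Strict Implicit.
Unset Printing Implicit Defensive.

Import Order.TTheory GRing.Theory Num.Theory.
Import numFieldNormedType.Exports.

Local Open Scope classical_set_scope.
Local Open Scope ring_scope.

(** The error of the linear estimator is n^(-1/2) times the Gaussian series
    sum_i g_i eps_i, so the first part is a statement about that series only.
    Independence enters through the law of the whole sequence (eps_i): a measure
    on the sequence space is determined by its values on finite-dimensional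
    boxes, hence this law does not change when the signs of any set of
    coordinates are reversed (flip_invariant).  Reflecting the coordinates from
    index k on exchanges S_n and 2 S_k - S_n, where S_n are the partial sums, and
    one of the two exceeds l in absolute value as soon as S_k does; this is
    Levy's inequality (levy_inequality).  With Chebyshev's inequality it gives
      P (sup_k |S_k| > l) <= 2 v |g|^2 / l^2,   v = E eps_0^2 < oo
    (maximal_inequality).  Applied to the tails of g it shows that the series
    converges almost surely, and applied to g itself that its sum is bounded in
    probability.

    For the second part put N = floor (n^(1/(2 alpha))), so that N/n is of the
    order of the rate.  The truncation estimator keeps exactly the first N
    coordinates; its risk is v N/n plus the sum of the squares of the remaining
    beta_i, which over B_alpha is at most of order N^(1 - 2 alpha), the same order.

    For the lower bound, the 2^N sequences with entries +- n^(-1/2) in the first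
    N places and 0 afterwards belong to B_alpha.  Take two of them that differ in
    the i-th place only.  An estimator defines a test of the sign of that place,
    and conditionally on all other coordinates this is a test between
    N(1, 1) and N(-1, 1) in units of n^(-1/2); both laws have a density bounded
    below on [-1, 1], so the two error probabilities add up to at least a
    constant (std_normal_testing, two_point_testing).  The conditioning is the
    identity resample, which replaces one coordinate of the noise by an
    independent copy and is again proved on boxes.  Averaging over the cube
    (cube_average) shows that at some vertex the N places together cost at least
    a constant times N/n (max_risk_ge). *)

(** * Power sums and square-summable sequences *)

Section PowerSums.
Variable R : realType.
Implicit Types (g beta : nat -> R) (alpha r : R) (n k N : nat).

(** Dividing by (k+1)^(-r), this is 1 + r/(k+1) <= (k/(k+1))^(-r), which
    follows from 1 + y <= exp y and ln (1 - z) <= - z. *)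
Lemma powR_telescope r k : 0 < r -> (0 < k)%N ->
  r * k.+1%:R `^ (- (r + 1)) <= k%:R `^ (- r) - k.+1%:R `^ (- r).
Proof.
move=> r0 k0.
have kR : 0 < k%:R :> R by rewrite ltr0n.
have k1R : 0 < k.+1%:R :> R by rewrite ltr0n.
pose u : R := k%:R / k.+1%:R.
have u0 : 0 < u by rewrite divr_gt0.
have ku : k%:R = k.+1%:R * u :> R by rewrite mulrCA divff ?mulr1// gt_eqF.
rewrite ku powRM ?(ltW u0) ?(ltW k1R)// opprD powRD; last by apply/implyP => _; rewrite gt_eqF.
rewrite powR_inv1 ?(ltW k1R)//.
set y := k.+1%:R `^ (- r); have y0 : 0 <= y by exact: powR_ge0.
suff : 1 + r / k.+1%:R <= u `^ (- r).
  by move=> /(ler_wpM2l y0); rewrite mulrDr mulr1 (mulrCA r); rewrite lerBrDl.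
rewrite /powR gt_eqF//; apply: le_trans (expR_ge1Dx _); rewrite lerD2l mulNr -mulrN.
rewrite ler_pM2l// lerNr.
have -> : u = 1 + - k.+1%:R^-1.
  by rewrite /u -natr1 mulrC; field; rewrite natr1 gt_eqF.
apply: le_ln1Dx; rewrite ltrN2 invf_lt1// ltr1n ltnS//.
Qed.

Lemma sum_powR_le r N n : 0 < r -> (0 < N)%N ->
  \sum_(N <= i < n) i.+1%:R `^ (- (r + 1)) <= r^-1 * N%:R `^ (- r).
Proof.
move=> r0 N0; have [Nn|/ltnW nN] := leqP N n; last first.
  by rewrite big_geq// mulr_ge0 ?invr_ge0 ?(ltW r0) ?powR_ge0.
suff : \sum_(N <= i < n) i.+1%:R `^ (- (r + 1)) <=
       r^-1 * (N%:R `^ (- r) - n%:R `^ (- r)).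
  move=> /le_trans; apply; rewrite ler_pM2l ?invr_gt0// gerBl.
  exact: powR_ge0.
rewrite ler_pdivlMl// mulr_sumr.
pose f i : R := - (i%:R `^ (- r)).
have -> : N%:R `^ (- r) - n%:R `^ (- r) = f n - f N by rewrite /f opprK addrC.
rewrite -telescope_sumr// /f.
apply: ler_sum_nat => i /andP[Ni _]; rewrite opprK [leRHS]addrC.
by apply: powR_telescope => //; exact: leq_trans Ni.
Qed.

Variables (alpha : R).
Hypothesis alpha_gt : 1 / 2 < alpha.

(** The squared bias of truncating at level N, uniformly over B_alpha. *)
Lemma B_alpha_tail beta N : B_alpha alpha beta -> (0 < N)%N ->
  (\sum_(N <= i <oo) ((beta i) ^+ 2)%:E <=
   ((2 * alpha - 1)^-1 * N%:R `^ (- (2 * alpha - 1)))%:E)%E.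
Proof.
move=> Bb N0; apply: lime_le.
  by apply: is_cvg_nneseries => i _ _; rewrite lee_fin sqr_ge0.
apply: nearW => n; rewrite sumEFin lee_fin.
have r0 : 0 < 2 * alpha - 1 by move: alpha_gt; lra.
apply: le_trans (sum_powR_le n r0 N0); apply: ler_sum => i _.
rewrite subrK -mulrN mulrC powRrM powR_mulrn ?powR_ge0//.
rewrite -real_normK ?num_real// ler_sqr ?nnegrE ?powR_ge0//.
Qed.

Lemma B_alpha_ell2 beta : B_alpha alpha beta -> ell2 beta.
Proof.
move=> Bb; rewrite /ell2 /sq_norm (nneseries_split 0 1)//; last first.
  by move=> i _; rewrite lee_fin sqr_ge0.
rewrite sumEFin; apply: lte_add_pinfty; first exact: ltry.
by apply: le_lt_trans (B_alpha_tail Bb (ltn0Sn 0)) _; exact: ltry.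
Qed.

End PowerSums.

Lemma ell2_series (R : realType) (x : nat -> R) :
  ell2 x -> cvgn (series (fun i => x i ^+ 2)).
Proof.
move=> x2; apply: nondecreasing_is_cvgn.
  by apply: nondecreasing_series => i _ _; exact: sqr_ge0.
exists (fine (sq_norm x)) => _ [n _ <-].
have fin : sq_norm x \is a fin_num.
  by rewrite ge0_fin_numE//; apply: nneseries_ge0 => i _ _; rewrite lee_fin sqr_ge0.
rewrite -lee_fin fineK// /series/= -sumEFin.
by apply: nneseries_lim_ge => i _ _; rewrite lee_fin sqr_ge0.
Qed.

Lemma ell2_cvg_inner (R : realType) (x y : nat -> R) :
  ell2 x -> ell2 y -> cvgn (series (fun i => x i * y i)).
Proof.
move=> x2 y2; apply: normed_cvg.
apply: (series_le_cvg (v_ := (fun i => x i ^+ 2) + (fun i => y i ^+ 2))).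
- by move=> i; exact: normr_ge0.
- by move=> i; rewrite addr_ge0// sqr_ge0.
- move=> i /=; rewrite normrM.
  rewrite -[X in _ <= X]/(x i ^+ 2 + y i ^+ 2).
  rewrite -(real_normK (num_real (x i))) -(real_normK (num_real (y i))).
  have := sqr_ge0 (`|x i| - `|y i|).
  have := mulr_ge0 (normr_ge0 (x i)) (normr_ge0 (y i)).
  by rewrite sqrrB mulr2n; lra.
- by apply: is_cvg_seriesD; exact: ell2_series.
Qed.

(** * Boxes and Gaussian product measures on the sequence space *)

Section Boxes.
Variable R : realType.
Implicit Types (n m : nat) (A B : nat -> set R).

Definition box n A : set (seq_space R) :=
  [set x | forall i, (i < n)%N -> A i (x i)].

Lemma measurable_coord i :
  measurable_fun [set: seq_space R] (fun x : seq_space R => x i).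
Proof.
move=> _ A mA; apply: sub_sigma_algebra; exists i => //.
by exists A.
Qed.

Lemma measurable_seq_spaceP d (T : measurableType d) (f : T -> seq_space R) :
  (forall i, measurable_fun [set: T] (fun t => f t i)) ->
  measurable_fun [set: T] f.
Proof.
move=> mf; apply: (@measurability _ _ T (seq_space R) setT f (cylinders R)) => //.
move=> _ [_ [i _ [A mA <-]] <-].
have := mf i measurableT A mA.
by rewrite !setTI.
Qed.

Lemma measurable_box n A : (forall i, measurable (A i)) -> measurable (box n A).
Proof.
move=> mA.
have -> : box n A = \bigcap_(i in `I_n) ((fun x : seq_space R => x i) @^-1` A i).
  by apply/seteqP; split=> x bx i /= /bx.
apply: fin_bigcap_measurable => // i _.
rewrite -[X in measurable X]setTI; exact: measurable_coord.
Qed.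

Definition boxes : set (set (seq_space R)) :=
  [set D | exists n A, (forall i, measurable (A i)) /\ D = box n A].

Lemma setI_closed_boxes : setI_closed boxes.
Proof.
move=> _ _ [n [A [mA ->]]] [m [B [mB ->]]].
exists (maxn n m), (fun i => (if (i < n)%N then A i else setT) `&`
                             (if (i < m)%N then B i else setT)).
split=> [i|]; first by apply: measurableI; case: ifP.
apply/seteqP; split=> [x [xA xB] i _|x xAB].
  by split; case: ifP => // ?; [exact: xA|exact: xB].
split=> i ilt.
  by have := xAB i; rewrite leq_max ilt => /(_ isT) -[].
by have := xAB i; rewrite leq_max ilt orbT => /(_ isT) -[].
Qed.

Lemma boxes_generate : @measurable _ (seq_space R) = <<s boxes >>.
Proof.
apply/seteqP; split.
  apply: smallest_sub; first exact: smallest_sigma_algebra.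
  move=> _ [i _ [A mA <-]]; apply: sub_sigma_algebra.
  exists i.+1, (fun j => if j == i then A else setT); split.
    by move=> j; case: ifP.
  rewrite setTI; apply/seteqP; split=> x /=.
    by move=> Ax j _; case: eqP => // ->.
  by move=> /(_ i (ltnSn i)); rewrite eqxx.
apply: smallest_sub; first exact: sigma_algebra_measurable.
by move=> _ [n [A [mA ->]]]; exact: measurable_box.
Qed.

(** The coordinates are i.i.d. standard normal under L, stated on boxes so that
    two laws with this property can be compared by uniqueness of measures. *)
Definition gaussian_product (L : set (seq_space R) -> \bar R) :=
  forall n A, (forall i, measurable (A i)) ->
    L (box n A) = (\prod_(i < n) normal_prob 0 1 (A i))%E.

Lemma gaussian_product_unique
    (L1 L2 : {measure set (seq_space R) -> \bar R}) :
  gaussian_product L1 -> gaussian_product L2 ->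
  forall D, measurable D -> L1 D = L2 D.
Proof.
move=> g1 g2 D mD.
have box0 : box 0 (fun=> setT) = setT :> set (seq_space R).
  by apply/seteqP; split.
apply: (measure_unique boxes (fun=> setT)) => //.
- exact: boxes_generate.
- exact: setI_closed_boxes.
- by move=> _; exists 0%N, (fun=> setT); split.
- by apply/seteqP; split => // x _; exists 0%N.
- by move=> _ [n [A [mA ->]]]; rewrite g1// g2.
- move=> _ /=; rewrite -box0 g1 ?big_ord0 ?ltry//.
Qed.

End Boxes.

(** * The standard normal law on the line *)

Section StdNormal.
Variable R : realType.
Local Notation mu := (@lebesgue_measure R).
Local Notation N01 := (@normal_prob R 0 1).

Lemma std_normal_opp (A : set R) : measurable A -> N01 (-%R @^-1` A) = N01 A.
Proof.
move=> mA; rewrite /normal_prob.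
have mpdf : measurable_fun [set: R] (EFin \o normal_pdf (0 : R) 1).
  by apply/measurable_EFinP; exact: measurable_normal_pdf.
transitivity (\int[pushforward mu (-%R : _ -> measurableTypeR R)]_(x in A)
   (normal_pdf 0 1 x)%:E)%E; last first.
  apply: eq_measure_integral => B mB _; exact: lebesgue_measureN.
rewrite ge0_integral_pushforward//=.
- apply: eq_integral => x _; congr EFin; rewrite normal_pdfE ?oner_eq0//=.
  by rewrite /normal_fun !subr0 sqrrN.
- exact: measurable_funTS.
- by move=> x _; rewrite lee_fin normal_pdf_ge0.
Qed.

Lemma lebesgue_measure_shift (a : R) (A : set R) : measurable A ->
  pushforward mu ((+%R a) : _ -> measurableTypeR R) A = mu A.
Proof.
move=> mA.
apply/esym/lebesgue_measure_unique => //=.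
  exact: measurable_funD.
move=> ? _ [[x y]] _ <-.
rewrite /pushforward.
rewrite (_ : +%R a @^-1` _ = `]x - a, y - a]%classic); last first.
  by apply/seteqP; split=> z /=; rewrite !in_itv/= ltrBlDl lerBrDl.
rewrite !lebesgue_measure_itv/= !lte_fin ltrD2r; case: ifP => // _.
by rewrite -!EFinD; congr EFin; rewrite opprD opprK addrACA addNr addr0.
Qed.

(** The normal density is a Radon-Nikodym derivative of the normal law. *)
Lemma ge0_integral_std_normal (f : R -> \bar R) :
  measurable_fun [set: R] f -> (forall x, 0 <= f x)%E ->
  (\int[N01]_x f x = \int[mu]_x (f x * (normal_pdf 0 1 x)%:E))%E.
Proof.
move=> mf f0.
have dom := @normal_prob_dominates R 0 1.
rewrite -(Radon_Nikodym_SigmaFinite.change_of_variables dom)//.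
apply: ae_eq_integral => //.
- apply: emeasurable_funM => //; apply: (measurable_int mu).
  exact: Radon_Nikodym_SigmaFinite.f_integrable.
- apply: emeasurable_funM => //; apply/measurable_EFinP.
  exact: measurable_normal_pdf.
- apply: ae_eqe_mul2l => /=; apply: integral_ae_eq => //=.
  + exact: Radon_Nikodym_SigmaFinite.f_integrable.
  + by apply/measurable_EFinP; exact: measurable_normal_pdf.
  + by move=> E _ mE; rewrite -Radon_Nikodym_SigmaFinite.f_integral.
Qed.

(** Since (t^2/4) exp (- t^2/4) <= 1, the function t^2 times the density of N(0, 1)
    is at most a multiple of the density of N(0, 2), which is integrable. *)
Lemma std_normal_second_moment : (\int[N01]_x (x ^+ 2)%:E < +oo)%E.
Proof.
rewrite ge0_integral_std_normal//; last first.
- by move=> x; rewrite lee_fin sqr_ge0.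
- by apply/measurable_EFinP; exact: measurable_funX.
pose s := Num.sqrt 2 : R.
have s0 : s != 0 by rewrite gt_eqF// sqrtr_gt0.
pose K := 4 * normal_peak 1 / normal_peak s : R.
have K0 : 0 <= K by rewrite !mulr_ge0// ?invr_ge0 ?normal_peak_ge0.
apply: (@le_lt_trans _ _ (\int[mu]_x (K%:E * (normal_pdf 0 s x)%:E))%E).
  apply: ge0_le_integral => //.
  - by move=> x _; rewrite mule_ge0// lee_fin ?sqr_ge0 ?normal_pdf_ge0.
  - apply: emeasurable_funM; apply/measurable_EFinP; first exact: measurable_funX.
    exact: measurable_normal_pdf.
  - by apply: measurable_funeM; apply/measurable_EFinP; exact: measurable_normal_pdf.
  - move=> x _; rewrite -!EFinM lee_fin !normal_pdfE// ?oner_eq0// /normal_fun.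
    rewrite !subr0 sqr_sqrtr// expr1n /K.
    have P0 := @normal_peak_ge0 R 1.
    have Q0 : normal_peak s != 0 by rewrite gt_eqF// normal_peak_gt0.
    set y := x ^+ 2; set q := normal_peak s in Q0 *; set p := normal_peak 1 in P0 *.
    rewrite (_ : - y / (1 *+ 2) = - (y / 4) + - (y / 4)); last by field.
    rewrite (_ : - y / (2 *+ 2) = - (y / 4)); last by field.
    rewrite expRD; set e := expR _.
    have e0 : 0 < e by exact: expR_gt0.
    have ye : y / 4 * e <= 1.
      rewrite /e expRN ler_pdivrMr ?expR_gt0// mul1r.
      by apply: le_trans (expR_ge1Dx _); rewrite lerDr.
    rewrite (_ : y * (p * (e * e)) = (4 * p * e) * (y / 4 * e)); last by field.
    rewrite (_ : (4 * p / q) * _ = (4 * p * e) * 1); last by field.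
    by rewrite ler_wpM2l// !mulr_ge0// ltW.
rewrite ge0_integralZl//; first last.
- by move=> x _; rewrite lee_fin normal_pdf_ge0.
- by apply/measurable_EFinP; exact: measurable_normal_pdf.
by rewrite integral_normal_pdf mule1 ltry.
Qed.

Let p2 : R := normal_pdf 0 1 2.

(** On [-1, 1] the density of N(a, 1) at x is at least the standard normal density
    at 2, because |x - a| <= 2 there. *)
Lemma std_normal_shift_ge (a : R) (B : set R) : `|a| <= 1 -> measurable B ->
  (p2%:E * mu (B `&` `[(-1)%R, 1%R]) <= N01 (+%R a @^-1` B))%E.
Proof.
move=> a1 mB.
have mB1 : measurable (B `&` `[(-1)%R, 1%R]) by exact: measurableI.
have ma : measurable_fun [set: R] (+%R a) by exact: measurable_funD.
have mpre (C : set R) : measurable C -> measurable (+%R a @^-1` C).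
  by move=> mC; rewrite -[X in measurable X]setTI; exact: ma.
have mpdf D : measurable_fun D (EFin \o normal_pdf (0 : R) 1).
  by apply/measurable_funTS/measurable_EFinP; exact: measurable_normal_pdf.
rewrite -(lebesgue_measure_shift a)// /pushforward.
apply: (@le_trans _ _ (N01 (+%R a @^-1` (B `&` `[(-1)%R, 1%R])))); last first.
  by apply: le_measure; rewrite ?inE//; [exact: mpre|exact: mpre|move=> x []].
rewrite -integral_cst; last exact: mpre.
apply: ge0_le_integral => //.
- exact: mpre.
- by move=> x _; rewrite lee_fin normal_pdf_ge0.
- exact: mpdf.
- move=> x [_]; rewrite /= in_itv/= => /andP[x1 x2].
  rewrite lee_fin /p2 !normal_pdfE ?oner_eq0//.
  rewrite ler_wpM2l ?normal_peak_ge0// /normal_fun ler_expR !subr0.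
  rewrite ler_pM2r ?invr_gt0 ?expr1n ?mulrn_wgt0// lerN2.
  move: a1; rewrite ler_norml => /andP[a1 a2].
  rewrite -ler_sqrt ?sqr_ge0// !sqrtr_sqr (ger0_norm (_ : 0 <= 2))// ler_norml.
  apply/andP; split.
    by lra.
  by lra.
Qed.

(** No test A separates N(1, 1) from N(-1, 1): they share a fixed mass
    on [-1, 1]. *)
Lemma std_normal_testing : exists2 c : R, 0 < c & forall A : set R, measurable A ->
  (c%:E <= N01 [set t | A (1 + t)%R] + N01 [set t | ~ A (- 1 + t)%R])%E.
Proof.
exists (p2 * 2).
  rewrite mulr_gt0// /p2 normal_pdfE ?oner_eq0// mulr_gt0 ?expR_gt0//.
  by rewrite normal_peak_gt0// oner_eq0.
move=> A mA.
have p20 : 0 <= p2 by rewrite normal_pdf_ge0.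
have -> : (p2 * 2)%:E = (p2%:E * mu (A `&` `[(-1)%R, 1%R]) +
                         p2%:E * mu (~` A `&` `[(-1)%R, 1%R]))%E.
  rewrite -ge0_muleDr//.
  have -> : (mu (A `&` `[(-1)%R, 1%R]) + mu (~` A `&` `[(-1)%R, 1%R]) = mu `[(-1)%R, 1%R])%E.
    rewrite -measureU//.
    - by rewrite -setIUl setUv setTI.
    - exact: measurableI.
    - by apply: measurableI => //; exact: measurableC.
    - by rewrite setIACA setICr set0I.
  rewrite lebesgue_measure_itv/= lte_fin ifT; last by lra.
  by rewrite -EFinD -EFinM opprK.
apply: leeD.
  by apply: std_normal_shift_ge => //; rewrite normr1.
by apply: std_normal_shift_ge; [rewrite normrN1|exact: measurableC].
Qed.

End StdNormal.

(** * Sign flips and resampling of one coordinate *)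

Section GaussianProduct.
Variables (R : realType) (L : probability (seq_space R) R).
Hypothesis gL : gaussian_product L.
Local Notation N01 := (@normal_prob R 0 1).

Definition flip (S : pred nat) (x : seq_space R) : seq_space R :=
  fun i => if S i then - x i else x i.

Lemma measurable_flip S : measurable_fun [set: seq_space R] (flip S).
Proof.
apply: measurable_seq_spaceP => i; rewrite /flip; case: (S i).
  by apply: measurable_funN; exact: measurable_coord.
exact: measurable_coord.
Qed.

(** The standard normal law is symmetric, so flipping signs maps a box to a box
    of the same measure. *)
Lemma flip_invariant S (D : set (seq_space R)) : measurable D ->
  pushforward L (flip S) D = L D.
Proof.
apply: gaussian_product_unique => //=; first exact: measurable_flip.
move=> mS n A mA; rewrite /pushforward.
have -> : flip S @^-1` box n A =
          box n (fun i => if S i then -%R @^-1` A i else A i).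
  by apply/seteqP; split => x xA i /xA; rewrite /flip; case: (S i).
rewrite gL => [|i].
  by apply: eq_bigr => i _; case: (S i) => //; exact: std_normal_opp.
case: (S i) => //; rewrite -[X in measurable X]setTI.
exact: oppr_measurable.
Qed.

Lemma ge0_integral_flip S (f : seq_space R -> \bar R) :
  measurable_fun [set: seq_space R] f -> (forall x, 0 <= f x)%E ->
  (\int[L]_x f (flip S x) = \int[L]_x f x)%E.
Proof.
move=> mf f0.
transitivity (\int[pushforward L (flip S)]_x f x)%E.
  by rewrite ge0_integral_pushforward//; exact: measurable_flip.
apply: eq_measure_integral => [|mS D mD _]; first exact: measurable_flip.
exact: flip_invariant.
Qed.

(** Typed so that its law and the normal law are measures on the same measurable
    space. *)
Definition coord i (x : seq_space R) : measurableTypeR R := x i.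

Lemma coord_law i (A : set R) : measurable A ->
  pushforward L (coord i) A = N01 A.
Proof.
move=> mA; rewrite /pushforward.
have -> : coord i @^-1` A =
          box i.+1 (fun j => if j == i then A else setT).
  apply/seteqP; split => [x xA j _|x /(_ i (ltnSn i))]; rewrite /= ?eqxx//.
  by case: eqP => // ->.
rewrite gL => [|j]; last by case: ifP.
rewrite big_ord_recr/= eqxx big1 ?mul1e// => j _.
by rewrite ltn_eqF//; exact: probability_setT.
Qed.

Lemma ge0_integral_coord i (f : R -> \bar R) :
  measurable_fun [set: R] f -> (forall t, 0 <= f t)%E ->
  (\int[L]_x f (x i) = \int[N01]_t f t)%E.
Proof.
move=> mf f0.
have mi : measurable_fun [set: seq_space R] (coord i) by exact: measurable_coord.
transitivity (\int[pushforward L (coord i)]_t f t)%E.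
  by rewrite ge0_integral_pushforward.
by apply: eq_measure_integral => // A mA _; exact: coord_law.
Qed.

Definition update i (t : R) (x : seq_space R) : seq_space R :=
  fun j => if j == i then t else x j.

Lemma measurable_update i :
  measurable_fun [set: seq_space R * measurableTypeR R]
    (fun z : seq_space R * measurableTypeR R => update i z.2 z.1).
Proof.
apply: measurable_seq_spaceP => j; rewrite /update; case: (j == i).
  exact: measurable_snd.
exact: (measurableT_comp (@measurable_coord R j) measurable_fst).
Qed.

(** Replacing one coordinate by an independent standard normal variable does not
    change the law.  This is how a single observation is isolated from the
    others: given the rest of the sequence, an event becomes a subset of the
    line. *)
Lemma resample i (D : set (seq_space R)) : measurable D ->
  L D = (\int[L]_x N01 [set t | D (update i t x)])%E.
Proof.
move=> mD.
have gp : gaussian_product (pushforward (L \x N01)%E (fun z : seq_space R * measurableTypeR R => update i z.2 z.1)).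
  move=> n A mA; rewrite /pushforward.
  (* Resampling frees the i-th constraint on x and puts it on t, when i < n. *)
  pose A' j := if j == i then setT else A j.
  pose B := if (i < n)%N then A i else setT.
  have mA' j : measurable (A' j) by rewrite /A'; case: ifP.
  have mB : measurable B by rewrite /B; case: ifP.
  have -> : (fun z : seq_space R * measurableTypeR R => update i z.2 z.1) @^-1` box n A =
            box n A' `*` B.
    apply/seteqP; split=> [[x t] /= xt|[x t] /= [xA tB] j jn].
      split=> [j jn|]; rewrite /A' /B.
        by have := xt j jn; rewrite /update; case: eqP.
      by case: ifP => // /xt; rewrite /update eqxx.
    rewrite /update; have := xA j jn; rewrite /A'.
    by case: eqP => // ji _; move: tB; rewrite /B -ji jn.
  rewrite product_measure1E//; last exact: measurable_box.
  rewrite [X in (X * _)%E](gL n mA') /B; case: ifPn => [lt_in|]; last first.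
    rewrite -leqNgt => le_ni.
    rewrite [X in (_ * X)%E](_ : _ = 1%E) ?mule1; last exact: (@probability_setT _ _ _ N01).
    apply: eq_bigr => j _; rewrite /A' ltn_eqF//.
    by rewrite (leq_trans _ le_ni).
  pose i' := Ordinal lt_in.
  rewrite (bigD1 i')//= [RHS](bigD1 i')//= {1}/A' eqxx.
  rewrite [X in ((X * _) * _)%E](_ : _ = 1%E) ?mul1e; last exact: (@probability_setT _ _ _ N01).
  rewrite muleC; congr (_ * _)%E.
  apply: eq_bigr => j ji; rewrite /A'; case: eqP => // ji'.
  by move: ji; rewrite -val_eqE/= ji' eqxx.
have mu := measurable_update i.
rewrite (gaussian_product_unique gL gp mD) /pushforward.
by apply: eq_integral => x _ /=; congr (N01 _); apply/seteqP; split => t;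
  rewrite /xsection/= inE.
Qed.

End GaussianProduct.

(** * Second moments of Gaussian partial sums *)

Section GaussianSeries.
Variables (R : realType) (L : probability (seq_space R) R).
Hypothesis gL : gaussian_product L.
Local Notation N01 := (@normal_prob R 0 1).
Local Notation v := (\int[N01]_t (t ^+ 2)%:E)%E.
Implicit Types (g : nat -> R) (n m k : nat).

Definition partial_sum g n (x : seq_space R) : R :=
  series (fun i => g i * x i) n.

Lemma partial_sumS g n x :
  partial_sum g n.+1 x = partial_sum g n x + g n * x n.
Proof. by rewrite /partial_sum /series/= big_nat_recr. Qed.

Lemma measurable_partial_sum g n :
  measurable_fun [set: seq_space R] (partial_sum g n).
Proof.
elim: n => [|n IHn].
  by rewrite (_ : partial_sum g 0 = cst 0)//; apply/funext => x;
    rewrite /partial_sum /series/= big_geq.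
rewrite (_ : partial_sum g n.+1 = fun x => partial_sum g n x + g n * x n).
  apply: measurable_funD => //; apply: measurable_funM => //.
  exact: measurable_coord.
by apply/funext => x; rewrite partial_sumS.
Qed.

Lemma partial_sum_flip_below g n k (x : seq_space R) : (n <= k)%N ->
  partial_sum g n (flip (fun i => k <= i)%N x) = partial_sum g n x.
Proof.
move=> nk; apply: eq_big_nat => i /andP[_ ilt].
by rewrite /flip leqNgt (leq_trans ilt nk).
Qed.

(** Changing the signs of the increments after time k reflects the walk about its value at
    time k. *)
Lemma partial_sum_flip_above g n k (x : seq_space R) : (k <= n)%N ->
  partial_sum g n (flip (fun i => k <= i)%N x) =
  partial_sum g k x *+ 2 - partial_sum g n x.
Proof.
move=> /subnK <-; elim: (n - k)%N => [|j IHj].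
  by rewrite add0n partial_sum_flip_below// mulr2n addrK.
rewrite addSn !partial_sumS IHj /flip leq_addl.
by rewrite mulrN opprD addrA.
Qed.

(** By flip invariance (s + g x)^2 and (s - g x)^2 have the same integral, and their mean
    is s^2 + g^2 x^2. *)
Lemma second_moment_partial_sum g n :
  (\int[L]_x (partial_sum g n x ^+ 2)%:E =
   (\sum_(0 <= i < n) g i ^+ 2)%:E * v)%E.
Proof.
have mS k : measurable_fun [set: seq_space R]
    (fun x => (partial_sum g k x ^+ 2)%:E).
  by apply/measurable_EFinP; apply: measurable_funX; exact: measurable_partial_sum.
have mx k : measurable_fun [set: seq_space R]
    (fun x : seq_space R => ((x k) ^+ 2)%:E).
  by apply/measurable_EFinP; apply: measurable_funX; exact: measurable_coord.
have sq0 (t : R) : (0 <= (t ^+ 2)%:E)%E by rewrite lee_fin sqr_ge0.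
elim: n => [|n IHn].
  rewrite big_geq// mul0e integral0_eq// => x _.
  by rewrite /partial_sum /series/= big_geq// expr0n.
pose a x := ((partial_sum g n.+1 x) ^+ 2)%:E.
pose fl := flip (R := R) (fun i => n <= i)%N.
have splitX (X : \bar R) : (0 <= X -> X = 2^-1%:E * X + 2^-1%:E * X)%E.
  move=> X0; rewrite -ge0_muleDl ?lee_fin ?invr_ge0//.
  by rewrite -EFinD (_ : 2^-1 + 2^-1 = 1) ?mul1e//; field.
have mfl : measurable_fun [set: seq_space R] fl by exact: measurable_flip.
have mafl : measurable_fun [set: seq_space R] (a \o fl).
  by apply: measurableT_comp => //; exact: mS.
rewrite [LHS]splitX; last by apply: integral_ge0 => x _; exact: sq0.
have ma : measurable_fun [set: seq_space R] a by exact: mS.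
have a0 x : (0 <= a x)%E by exact: sq0.
have h0 : (0 <= 2^-1%:E :> \bar R)%E by rewrite lee_fin invr_ge0.
rewrite -[X in (_ + _ * X)%E](ge0_integral_flip gL (fun i => n <= i)%N ma a0).
transitivity (\int[L]_x (2^-1%:E * a x) + \int[L]_x (2^-1%:E * a (fl x)))%E.
  by rewrite !ge0_integralZl.
rewrite -ge0_integralD//; last 4 first.
- by move=> x _; rewrite mule_ge0.
- exact: measurable_funeM.
- by move=> x _; rewrite mule_ge0.
- exact: measurable_funeM.
transitivity (\int[L]_x ((partial_sum g n x ^+ 2)%:E +
                         (g n ^+ 2)%:E * (x n ^+ 2)%:E)%E)%E.
  apply: eq_integral => x _; rewrite /a partial_sum_flip_above ?leqnSn//.
  by rewrite partial_sumS -!EFinM -!EFinD; congr EFin; field.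
rewrite ge0_integralD//; first last.
- exact: measurable_funeM.
- by move=> x _; rewrite mule_ge0.
rewrite IHn ge0_integralZl//.
rewrite (ge0_integral_coord gL n (f := fun t => (t ^+ 2)%:E))//; last first.
  by apply/measurable_EFinP; exact: measurable_funX.
rewrite big_nat_recr// EFinD; rewrite ge0_muleDl//.
by rewrite lee_fin sumr_ge0// => i _; rewrite sqr_ge0.
Qed.

End GaussianSeries.

(** * The maximal inequality *)

Section MaximalInequality.
Variables (R : realType) (L : probability (seq_space R) R).
Hypothesis gL : gaussian_product L.
Local Notation N01 := (@normal_prob R 0 1).
Local Notation v := (\int[N01]_t (t ^+ 2)%:E)%E.
Implicit Types (g : nat -> R) (n m k : nat) (l : R).

Definition exceed g l n : set (seq_space R) :=
  [set x | l < `|partial_sum g n x|].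

Lemma measurable_exceed g l n : measurable (exceed g l n).
Proof.
have mf : measurable_fun [set: seq_space R] (fun x => `|partial_sum g n x|).
  by apply: measurableT_comp => //; exact: measurable_partial_sum.
rewrite (_ : exceed g l n = (fun x => `|partial_sum g n x|) @^-1` `]l, +oo[).
  by rewrite -[X in measurable X]setTI; exact: mf.
by apply/seteqP; split => x /=; rewrite in_itv/= andbT.
Qed.

(** Split according to the first k at which the walk exceeds l.  On that event
    either S_n or its reflection 2 S_k - S_n exceeds l, and the event itself is
    unchanged by the reflection, which preserves L. *)
Lemma levy_inequality g l n :
  (L (\big[setU/set0]_(k < n.+1) exceed g l k) <= 2%:E * L (exceed g l n))%E.
Proof.
have mE := measurable_exceed g l.
rewrite bigsetU_seqDU; set A := seqDU _.
have mA k : measurable (A k) by exact: seqDU_measurable.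
have tA : trivIset setT A by exact: trivIset_seqDU.
have mAE k : measurable (A k `&` exceed g l n) by exact: measurableI.
rewrite measure_bigsetU//.
apply: (@le_trans _ _ (\sum_(k < n.+1) 2%:E * L (A k `&` exceed g l n))%E).
  apply: lee_sum => k _.
  pose fl := flip (R := R) (fun i => k <= i)%N.
  have mfl : measurable_fun [set: seq_space R] fl by exact: measurable_flip.
  have kn : (k <= n)%N by rewrite -ltnS.
  have Afl x : A k x -> A k (fl x).
    rewrite /A /seqDU -bigcup_mkord => -[xk xj]; split.
      by rewrite /exceed/= partial_sum_flip_below.
    move=> [j /= jk ej]; apply: xj; exists j => //.
    by move: ej; rewrite /exceed/= partial_sum_flip_below// ltnW.
  apply: (@le_trans _ _ (L ((A k `&` exceed g l n) `|`
                            fl @^-1` (A k `&` exceed g l n)))).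
    have mB : measurable (fl @^-1` (A k `&` exceed g l n)).
      by rewrite -[X in measurable X]setTI; exact: mfl.
    apply: le_measure; rewrite ?inE//; first exact: measurableU.
    move=> x Ax; have [xn|xn] := pselect (exceed g l n x); first by left.
    right; split; first exact: Afl.
    have /= xk : exceed g l k x by case: Ax.
    rewrite /exceed/= partial_sum_flip_above//.
    have /= := xn; rewrite /exceed/= => /negP; rewrite -leNgt => Sn.
    have := ler_normB (partial_sum g k x *+ 2 - partial_sum g n x) (- partial_sum g n x).
    rewrite opprK subrK normrMn normrN => h.
    have : l < `|partial_sum g k x| by [].
    by move: h Sn; rewrite mulr2n; lra.
  have mB : measurable (fl @^-1` (A k `&` exceed g l n)).
    by rewrite -[X in measurable X]setTI; exact: mfl.
  apply: le_trans; first exact: measureU2.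
  rewrite [X in (_ + X)%E](flip_invariant gL)//.
  by rewrite -[X in (X + X)%E]mul1e -ge0_muleDl.
rewrite -ge0_sume_distrr; last by move=> k _; exact: measure_ge0.
apply: lee_wpmul2l => //.
have tAE : trivIset setT (fun k => A k `&` exceed g l n) by exact: trivIset_setIr.
rewrite -(measure_bigsetU L mAE tAE).
apply: le_measure; rewrite ?inE//.
  by apply: bigsetU_measurable.
elim/big_ind : _ => [x []//|D D' sD sD' x [/sD|/sD']//|k _ x [_]//].
Qed.

Lemma chebyshev_partial_sum g l n : 0 < l ->
  (L (exceed g l n) <= (l ^- 2)%:E * (v * sq_norm g))%E.
Proof.
move=> l0; have mE := measurable_exceed g l.
have mS : measurable_fun [set: seq_space R] (fun x => (partial_sum g n x ^+ 2)%:E).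
  by apply/measurable_EFinP; apply: measurable_funX; exact: measurable_partial_sum.
rewrite lee_pdivlMl ?exprn_gt0//.
apply: (@le_trans _ _ (\int[L]_x (partial_sum g n x ^+ 2)%:E)%E).
  rewrite -integral_cst//.
  apply: (@le_trans _ _ (\int[L]_(x in exceed g l n) (partial_sum g n x ^+ 2)%:E)%E).
    apply: ge0_le_integral => //.
    - by move=> x _; rewrite lee_fin sqr_ge0.
    - exact: measurable_funTS.
    - move=> x /= lx; rewrite lee_fin -[leRHS]real_normK ?num_real//.
      by rewrite ler_sqr ?nnegrE// ltW.
  by apply: ge0_subset_integral => // x _; rewrite lee_fin sqr_ge0.
rewrite (second_moment_partial_sum gL) muleC; apply: lee_wpmul2l.
  by apply: integral_ge0 => x _; rewrite lee_fin sqr_ge0.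
rewrite -sumEFin; apply: nneseries_lim_ge => i _ _.
by rewrite lee_fin sqr_ge0.
Qed.

(** The union over all times is the increasing limit of the unions
    over finitely many times. *)
Lemma maximal_inequality g l : 0 < l ->
  (L (\bigcup_k exceed g l k) <= (2 * l ^- 2)%:E * (v * sq_norm g))%E.
Proof.
move=> l0; have mE := measurable_exceed g l.
pose F n := \big[setU/set0]_(k < n.+1) exceed g l k.
have mF n : measurable (F n) by exact: bigsetU_measurable.
have -> : \bigcup_k exceed g l k = \bigcup_n F n.
  apply/seteqP; split => x [k _]; rewrite /F.
    by exists k => //; rewrite -bigcup_mkord; exists k => //=.
  by rewrite -bigcup_mkord => -[j _ xj]; exists j.
have cF : L (F n) @[n --> \oo] --> L (\bigcup_n F n).
  apply: nondecreasing_cvg_mu => //; first exact: bigcup_measurable.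
  move=> n m nm; apply/subsetPset; rewrite /F -!bigcup_mkord => x [k /= kn xk].
  by exists k => //=; rewrite (leq_trans kn).
rewrite -(cvg_lim _ cF)//; apply: lime_le; first exact: cvgP cF.
apply: nearW => n; apply: (le_trans (levy_inequality g l n)).
rewrite EFinM -muleA; apply: lee_wpmul2l => //.
exact: chebyshev_partial_sum.
Qed.

End MaximalInequality.

(** * Almost sure convergence of Gaussian series *)

Section Convergence.
Variable R : realType.
Implicit Types (g : nat -> R) (n m k p : nat).

Definition tail g m : nat -> R := fun i => if (i < m)%N then 0 else g i.

Lemma partial_sum_tail g m n x : (m <= n)%N ->
  partial_sum (tail g m) n x = partial_sum g n x - partial_sum g m x.
Proof.
move=> mn; rewrite /partial_sum sub_series_geq// /series/=.
rewrite [LHS](big_cat_nat (leq0n m) mn)/= [X in X + _]big_nat big1 ?add0r => [|i im].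
  apply: eq_big_nat => i /andP[mi _]; by rewrite /tail ltnNge mi.
by rewrite /tail; case/andP: im => _ ->; rewrite mul0r.
Qed.

Lemma partial_sum_tail0 g m n x : (n <= m)%N -> partial_sum (tail g m) n x = 0.
Proof.
move=> nm; rewrite /partial_sum /series/= big_nat big1// => i /andP[_ ilt].
by rewrite /tail (leq_trans ilt)// mul0r.
Qed.

Lemma sq_norm_tail g m :
  sq_norm (tail g m) = (\sum_(m <= i <oo) (g i ^+ 2)%:E)%E.
Proof.
rewrite eseries_cond eseries_mkcond; apply: eq_eseriesr => i _.
by rewrite /tail (leqNgt m); case: (i < m)%N; rewrite //= expr2 mul0r.
Qed.

(** The partial sums of tail g m are S_k - S_m for k >= m and 0 for k < m, so this
    says that S moves by more than 1/(p+1) after every time m. *)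
Definition oscillates g p : set (seq_space R) :=
  \bigcap_m \bigcup_k exceed (tail g m) p.+1%:R^-1 k.

Lemma measurable_oscillates g p : measurable (oscillates g p).
Proof.
apply: bigcapT_measurable => m; apply: bigcupT_measurable => k.
exact: measurable_exceed.
Qed.

(** Cauchy's criterion; it makes the set of divergence a countable combination of
    measurable sets. *)
Lemma cvg_partial_sumP g x :
  cvgn (partial_sum g ^~ x) <-> ~ (\bigcup_p oscillates g p) x.
Proof.
split.
  move=> cS [p _ osc]; move/cvgrPdist_lt : (cS).
  have p0 : 0 < p.+1%:R^-1 / 2 :> R by rewrite divr_gt0// invr_gt0.
  move=> /(_ _ p0)[N _ hN].
  have [k _] := osc N Logic.I; rewrite /exceed/=.
  have [kN|Nk] := leqP k N.
    by rewrite partial_sum_tail0// normr0 ltNge invr_ge0 ler0n.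
  rewrite partial_sum_tail ?(ltnW Nk)//.
  have /= h1 := hN N (leqnn N); have /= h2 := hN k (ltnW Nk).
  move=> h.
  have := ler_distD (limn (partial_sum g ^~ x)) (partial_sum g k x) (partial_sum g N x).
  rewrite (distrC _ (limn _)) => tri.
  suff : p.+1%:R^-1 < p.+1%:R^-1 :> R by rewrite ltxx.
  by move: (p.+1%:R^-1 : R) h h1 h2 tri => r; lra.
move=> nosc; apply/cauchy_cvgP/cauchy_seriesP => e e0.
(* This p makes 1/(p+1) < e/2, so that two terms close to S_m are e-close. *)
pose p := Num.truncn (2 / e).
have pe : p.+1%:R^-1 < e / 2.
  rewrite -[ltRHS]invrK ltf_pV2 ?posrE ?invr_gt0 ?divr_gt0// invf_div.
  exact: truncnS_gt.
have [m hm] : exists m, forall k, ~ exceed (tail g m) p.+1%:R^-1 k x.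
  apply: contrapT => hx; apply: nosc; exists p => // m _.
  by apply: contrapT => hk; apply: hx; exists m => k hkx; apply: hk; exists k.
have {}hm k : (m <= k)%N -> `|partial_sum g k x - partial_sum g m x| < e / 2.
  move=> mk; rewrite -partial_sum_tail//; apply: le_lt_trans pe.
  by rewrite leNgt; apply/negP/hm.
near=> n => /=.
have n1 : (m <= n.1)%N by near: n; exists ([set i | m <= i]%N, setT); [split; [exists m|exact: filterT]|move=> [? ?] /= []].
have n2 : (m <= n.2)%N by near: n; exists (setT, [set i | m <= i]%N); [split; [exact: filterT|exists m]|move=> [? ?] /= []].
have [le12|/ltnW le21] := leqP n.1 n.2; last by rewrite big_geq// normr0.
have := ler_distD (partial_sum g m x) (partial_sum g n.1 x) (partial_sum g n.2 x).
rewrite -sub_series_geq// -/(partial_sum g n.2 x) -/(partial_sum g n.1 x).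
rewrite (distrC (partial_sum g n.1 x) (partial_sum g n.2 x)).
have := hm _ n1; have := hm _ n2; rewrite (distrC (partial_sum g n.2 x) (partial_sum g m x)).
by lra.
Unshelve. all: by end_near. Qed.

(** On the set of convergence this is a pointwise limit of measurable functions;
    outside it limn takes a constant default value. *)
Lemma measurable_linear_form g :
  measurable_fun [set: seq_space R] (linear_form g : seq_space R -> R).
Proof.
pose D := ~` (\bigcup_p oscillates g p).
have mD : measurable D.
  by apply: measurableC; apply: bigcupT_measurable => p; exact: measurable_oscillates.
have -> : [set: seq_space R] = D `|` ~` D by rewrite setUv.
apply/measurable_funU => //; first exact: measurableC.
split.
  apply: (@measurable_fun_cvg _ _ _ D (fun n x => partial_sum g n x)) => [n|x Dx].
    by apply: measurable_funTS; exact: measurable_partial_sum.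
  by have /cvg_partial_sumP := Dx.
apply: (@eq_measurable_fun _ _ _ _ _ (cst (point : R))) => [x|].
  rewrite inE => nDx; rewrite /linear_form dvgP// => /cvg_partial_sumP cx.
  exact: nDx.
exact: measurable_cst.
Qed.

Variable L : probability (seq_space R) R.
Hypothesis gL : gaussian_product L.

(** By the maximal inequality for the tails of g, each oscillation event has
    probability at most a multiple of the m-th tail of |g|^2, for every m. *)
Lemma gaussian_series_ae_cvg g : ell2 g -> L (\bigcup_p oscillates g p) = 0%E.
Proof.
move=> g2; have mosc := measurable_oscillates g.
apply/eqP; rewrite -measure_le0.
apply: (le_trans (measure_sigma_subadditive L mosc _ (@subset_refl _ _))).
  exact: bigcupT_measurable.
rewrite eseries0// => p _ _.
apply/eqP; rewrite -measure_le0.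
have hosc m : (L (oscillates g p) <=
    (2 * p.+1%:R^-1 ^- 2)%:E * (\int[normal_prob 0 1]_t (t ^+ 2)%:E *
      \sum_(m <= i <oo) (g i ^+ 2)%:E))%E.
  rewrite -sq_norm_tail; apply: le_trans (maximal_inequality gL _ _) => //.
  apply: le_measure; rewrite ?inE//.
    by apply: bigcupT_measurable => k; exact: measurable_exceed.
  exact: bigcap_inf.
have v0 : (0 <= \int[@normal_prob R 0 1]_t (t ^+ 2)%:E)%E.
  by apply: integral_ge0 => x _; rewrite lee_fin sqr_ge0.
have vfin : (\int[@normal_prob R 0 1]_t (t ^+ 2)%:E)%E \is a fin_num.
  by rewrite ge0_fin_numE//; exact: std_normal_second_moment.
have tail0 : (\sum_(m <= i <oo) (g i ^+ 2)%:E @[m --> \oo] --> 0)%E.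
  by apply: nneseries_tail_cvg => // k _; rewrite lee_fin sqr_ge0.
have := cvgeZl vfin tail0; rewrite mule0 => h.
have := cvgeZl (isT : (2 * p.+1%:R^-1 ^- 2)%:E \is a fin_num) h; rewrite mule0 => {}h.
rewrite -(cvg_lim _ h)//; apply: lime_ge; first exact: cvgP h.
by apply: nearW.
Qed.

End Convergence.

(** * The noise sequence and linear functionals *)

Section Noise.
Context (R : realType) (d : measure_display) (T : measurableType d).
Variables (P : probability T R) (eps : nat -> {RV P >-> R}).

Definition noise (w : T) : seq_space R := fun i => eps i w.

Lemma measurable_noise : measurable_fun [set: T] noise.
Proof. by apply: measurable_seq_spaceP => i. Qed.

HB.instance Definition _ := isMeasurableFun.Build _ _ _ _ noise measurable_noise.

Definition noise_law : probability (seq_space R) R :=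
  distribution P (noise : {RV P >-> seq_space R}).

Lemma noise_lawE (D : set (seq_space R)) : noise_law D = P (noise @^-1` D).
Proof. by []. Qed.

Lemma measurable_preimage_noise (D : set (seq_space R)) :
  measurable D -> measurable (noise @^-1` D).
Proof. by move=> mD; rewrite -[X in measurable X]setTI; exact: measurable_noise. Qed.

Lemma gaussian_noise : iid_std_normal eps -> gaussian_product noise_law.
Proof.
move=> [ind gau] n A mA; rewrite noise_lawE.
pose J := [fset i in iota 0 n]%fset.
have -> : noise @^-1` box n A = \bigcap_(i in [set` J]) (eps i @^-1` A i).
  apply/seteqP; split => [w wA i|w wA i ilt].
    by rewrite /J /= !inE mem_iota => /andP[_]; rewrite add0n; exact: wA.
  by apply: wA; rewrite /J/= !inE mem_iota add0n.
rewrite ind// -(big_mkord xpredT (fun i => normal_prob 0 1 (A i))).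
rewrite (perm_big (index_iota 0 n)).
  by apply: eq_bigr => i _; exact: gau.
apply: uniq_perm; [exact: fset_uniq|exact: iota_uniq|move=> i].
by rewrite /J /index_iota subn0 !inE.
Qed.

Lemma measurable_observation n beta :
  measurable_fun [set: T] (observation eps n beta).
Proof.
apply: measurable_seq_spaceP => i; rewrite /observation.
by apply: measurable_funD => //; apply: measurable_funM.
Qed.

Lemma series_observation n beta (g : nat -> R) w :
  series (fun i => g i * observation eps n beta w i) =
  series (fun i => g i * beta i) +
    (Num.sqrt n%:R)^-1 *: (series (fun i => g i * noise w i)).
Proof.
rewrite -seriesZ -seriesD; congr series; apply/funext => i.
by rewrite /observation /noise mulrDr mulrCA.
Qed.

Hypothesis Heps : iid_std_normal eps.

Lemma noise_series_ae_cvg (g : nat -> R) : ell2 g ->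
  {ae P, forall w, cvgn (series (fun i => g i * noise w i))}.
Proof.
move=> g2; exists (noise @^-1` (\bigcup_p oscillates g p)); split.
- by apply: measurable_preimage_noise; apply: bigcupT_measurable => p;
    exact: measurable_oscillates.
- exact: (gaussian_series_ae_cvg (gaussian_noise Heps) g2).
- move=> w /= nc; apply: contrapT => /cvg_partial_sumP; exact: nc.
Qed.

Lemma observation_series_ae_cvg n (g beta : nat -> R) : ell2 g -> ell2 beta ->
  {ae P, forall w, cvgn (series (fun i => g i * observation eps n beta w i))}.
Proof.
move=> g2 b2; apply: filterS (noise_series_ae_cvg g2) => w cw.
rewrite series_observation; apply: is_cvgD; first exact: ell2_cvg_inner.
exact: is_cvgZl_tmp.
Qed.

(** The normalised error is almost surely the sum of the series of the
    g_i eps_i, the same random variable for all n >= 1; it is at most M in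
    absolute value unless some partial sum exceeds M. *)
Lemma linear_form_sqrtn_consistent (g beta : nat -> R) : ell2 g -> ell2 beta ->
  sqrtn_consistent P
    (fun n w => linear_form g (observation eps n beta w)) (linear_form g beta).
Proof.
move=> g2 b2 e e0.
pose K := (\int[normal_prob 0 1]_t (t ^+ 2)%:E * sq_norm g)%E.
have v0 : (0 <= \int[@normal_prob R 0 1]_t (t ^+ 2)%:E)%E.
  by apply: integral_ge0 => x _; rewrite lee_fin sqr_ge0.
have sq0 : (0 <= sq_norm g)%E.
  by apply: nneseries_ge0 => i _ _; rewrite lee_fin sqr_ge0.
have K0 : (0 <= K)%E by exact: mule_ge0.
have Kfin : K \is a fin_num.
  by rewrite fin_numM// ge0_fin_numE//; exact: std_normal_second_moment.
pose k := fine K; have k0 : 0 <= k by exact: fine_ge0.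
(* The bound needed is 2 k / M^2 <= e; since M >= 1, 2 k <= e M suffices. *)
exists (1 + 2 * k / e); first by rewrite ltr_pwDl// divr_ge0 ?mulr_ge0// ltW.
set M := 1 + _.
have M1 : 1 <= M by rewrite lerDl divr_ge0 ?mulr_ge0// ltW.
have M0 : 0 < M by exact: lt_le_trans M1.
near=> n.
have n0 : (0 < n)%N by near: n; exists 1%N.
have sn : Num.sqrt n%:R != 0 :> R by rewrite gt_eqF// sqrtr_gt0 ltr0n.
(* Outside B the series converges and its partial sums are at most M. *)
pose B : set (seq_space R) := (\bigcup_p oscillates g p) `|` \bigcup_k exceed g M k.
have mosc : measurable (\bigcup_p oscillates g p).
  by apply: bigcupT_measurable => p; exact: measurable_oscillates.
have mexc : measurable (\bigcup_k exceed g M k).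
  by apply: bigcupT_measurable => j; exact: measurable_exceed.
have mB : measurable B by exact: measurableU.
have gL := gaussian_noise Heps.
apply: (@le_trans _ _ (noise_law B)).
  rewrite noise_lawE; apply: le_measure; rewrite ?inE.
  - set Z := fun w : T => Num.sqrt n%:R * (linear_form g (observation eps n beta w) - linear_form g beta).
    have mZ : measurable_fun [set: T] (fun w => `|Z w|).
      apply: measurableT_comp => //; apply: measurable_funM => //.
      apply: measurable_funB => //.
      apply: (measurableT_comp (measurable_linear_form g)).
      exact: measurable_observation.
    rewrite (_ : [set w | _] = (fun w => `|Z w|) @^-1` `]M, +oo[).
      by rewrite -[X in measurable X]setTI; exact: mZ.
    by apply/seteqP; split => w /=; rewrite in_itv/= andbT.
  - exact: measurable_preimage_noise.
  - move=> w /= hw; have [osc|nosc] := pselect ((\bigcup_p oscillates g p) (noise w)).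
      by left.
    right; apply: contrapT => nex.
    have cw := (cvg_partial_sumP g (noise w)).2 nosc.
    suff : `|limn (partial_sum g ^~ (noise w))| <= M.
      move=> h; move: hw; rewrite ltNge => /negP; apply.
      rewrite /linear_form series_observation limD; first last.
      - exact: is_cvgZl_tmp.
      - exact: ell2_cvg_inner.
      rewrite limZl_tmp// addrAC subrr add0r.
      by rewrite /GRing.scale/= mulrA divff// mul1r.
    rewrite -lim_norm//; apply: limr_le; first exact: is_cvg_norm.
    apply: nearW => j; rewrite leNgt; apply/negP => hj; apply: nex; by exists j.
rewrite (le_trans (measureU2 _ mosc mexc))//.
rewrite [X in (X + _)%E](gaussian_series_ae_cvg gL g2) add0e.
apply: le_trans; first exact: maximal_inequality.
rewrite -/K -(fineK Kfin) -EFinM lee_fin -/k.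
rewrite mulrAC ler_pdivrMr ?exprn_gt0//.
have : 2 * k <= e * M.
  by rewrite mulrDr mulr1 mulrCA divff ?gt_eqF// mulr1 lerDr ltW.
move=> /le_trans; apply; rewrite ler_pM2l// expr2 ler_peMl// ltW.
Unshelve. all: by end_near. Qed.

End Noise.

(** * The truncation level and the rate *)

Section Cutoff.
Variables (R : realType) (alpha : R).
Hypothesis alpha_gt : 1 / 2 < alpha.

Let alpha_gt0 : 0 < alpha. Proof. by move: alpha_gt; lra. Qed.

(** The number N of coordinates kept by the estimator; see cutoffE. *)
Definition cutoff (n : nat) : nat := Num.truncn (n%:R `^ (2 * alpha)^-1 : R).

Definition rate (n : nat) : R := n%:R `^ (- ((2 * alpha - 1) / (2 * alpha))).

Lemma cutoffE n i : (i.+1%:R `^ alpha <= Num.sqrt n%:R) = (i < cutoff n)%N.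
Proof.
rewrite /cutoff truncn_gt_nat.
rewrite -powR12_sqrt// invfM powRrM.
have inv0 : 0 <= alpha^-1 by rewrite invr_ge0 ltW.
have ge0 := @ler0n R.
have alphaK (y : R) : 0 <= y -> (y `^ alpha) `^ alpha^-1 = y.
  by move=> y0; rewrite -powRrM divff ?powRr1// lt0r_neq0.
have alphaVK (y : R) : 0 <= y -> (y `^ alpha^-1) `^ alpha = y.
  by move=> y0; rewrite -powRrM mulVf ?powRr1// lt0r_neq0.
set y := n%:R `^ 2^-1; have y0 : 0 <= y by exact: powR_ge0.
set x : R := i.+1%:R; have x0 : 0 <= x by exact: ler0n.
have nneg (z : R) : 0 <= z -> z \in Num.nneg by rewrite nnegrE.
apply/idP/idP => h.
  have := ge0_ler_powR inv0 (nneg _ (powR_ge0 x alpha)) (nneg _ y0) h.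
  by rewrite (alphaK _ x0).
have := ge0_ler_powR (ltW alpha_gt0) (nneg _ x0) (nneg _ (powR_ge0 y alpha^-1)) h.
by rewrite (alphaVK _ y0).
Qed.

Lemma cutoff_bounds n : (0 < n)%N ->
  [/\ (0 < cutoff n)%N,
      (cutoff n)%:R <= n%:R `^ (2 * alpha)^-1 :> R &
      n%:R `^ (2 * alpha)^-1 <= 2 * (cutoff n)%:R :> R].
Proof.
move=> n0.
have x1 : 1 <= n%:R `^ (2 * alpha)^-1 :> R.
  rewrite -[leLHS](powRr0 n%:R); apply: ler_powR; first by rewrite ler1n.
  by rewrite invr_ge0 mulr_ge0// ltW.
have N0 : (0 < cutoff n)%N by rewrite truncn_gt0.
split => //; first by rewrite truncn_le powR_ge0.
apply: (le_trans (ltW (truncnS_gt _))).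
rewrite -/(cutoff n) -natr1 mulr_natl mulr2n lerD2l ler1n//.
Qed.

Lemma rateE n : (0 < n)%N -> rate n = n%:R `^ (2 * alpha)^-1 / n%:R.
Proof.
move=> n0; rewrite /rate -(powR_inv1 (ler0n R n)) -powRD; last first.
  by apply/implyP => _; rewrite pnatr_eq0 -lt0n.
by congr (_ `^ _); field; rewrite gt_eqF.
Qed.

Lemma cutoff_div_le n : (0 < n)%N -> (cutoff n)%:R / n%:R <= rate n.
Proof.
move=> n0; have [_ h _] := cutoff_bounds n0.
by rewrite rateE// ler_pM2r ?invr_gt0 ?ltr0n.
Qed.

Lemma cutoff_div_ge n : (0 < n)%N -> rate n <= 2 * ((cutoff n)%:R / n%:R).
Proof.
move=> n0; have [_ _ h] := cutoff_bounds n0.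
by rewrite rateE// mulrA ler_pM2r ?invr_gt0 ?ltr0n.
Qed.

Lemma cutoff_powR_le n : (0 < n)%N ->
  (cutoff n)%:R `^ (- (2 * alpha - 1)) <= 2 `^ (2 * alpha - 1) * rate n.
Proof.
move=> n0; have [N0 _ h] := cutoff_bounds n0.
have r0 : 0 <= 2 * alpha - 1 by move: alpha_gt; lra.
have -> : rate n = (n%:R `^ (2 * alpha)^-1) `^ (- (2 * alpha - 1)).
  by rewrite /rate -powRrM; congr (_ `^ _); rewrite mulrN mulrC.
rewrite !powRN -ler_pdivrMl ?powR_gt0// -invfM lef_pV2 ?posrE.
- by rewrite -powRM//; apply: ge0_ler_powR; rewrite ?nnegrE ?powR_ge0 ?mulr_ge0.
- by rewrite mulr_gt0 ?powR_gt0// ltr0n.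
- by rewrite powR_gt0// powR_gt0// ltr0n.
Qed.

Lemma beta_hat_estimator n : estimator (@beta_hat R alpha n).
Proof.
split.
  apply: measurable_seq_spaceP => i; rewrite /beta_hat.
  case: (i.+1%:R `^ alpha <= _); last exact: measurable_cst.
  exact: measurable_coord.
move=> x; rewrite /ell2 /sq_norm (nneseries_split 0 (cutoff n))//; last first.
  by move=> i _; rewrite lee_fin sqr_ge0.
rewrite sumEFin eseries0 ?adde0 ?ltry// => i; rewrite add0n => Ni _.
by rewrite /beta_hat cutoffE ltnNge Ni expr0n.
Qed.

End Cutoff.

(** * Upper bound on the risk *)

Section UpperBound.
Context (R : realType) (d : measure_display) (T : measurableType d).
Variables (P : probability T R) (eps : nat -> {RV P >-> R}).
Hypothesis Heps : iid_std_normal eps.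
Variable alpha : R.
Hypothesis alpha_gt : 1 / 2 < alpha.
Local Notation v := (\int[@normal_prob R 0 1]_t (t ^+ 2)%:E)%E.

Lemma second_moment_noise i : (\int[P]_w ((noise eps w i) ^+ 2)%:E = v)%E.
Proof.
have mf : measurable_fun [set: R] (fun t : R => (t ^+ 2)%:E).
  by apply/measurable_EFinP; exact: measurable_funX.
have mfi : measurable_fun [set: seq_space R] (fun x => (x i ^+ 2)%:E).
  by apply: (measurableT_comp mf); exact: measurable_coord.
have f0 (t : R) : (0 <= (t ^+ 2)%:E)%E by rewrite lee_fin sqr_ge0.
rewrite -(ge0_integral_coord (gaussian_noise Heps) i mf f0).
by rewrite ge0_integral_distribution.
Qed.

(** Variance of the coordinates that are kept plus squared bias of the others. *)
Lemma risk_beta_hatE n beta : (0 < n)%N ->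
  risk eps n (@beta_hat R alpha n) beta =
  (((cutoff alpha n)%:R / n%:R)%:E * v +
   \sum_(cutoff alpha n <= i <oo) (beta i ^+ 2)%:E)%E.
Proof.
move=> n0; rewrite /risk; set N := cutoff alpha n.
have sq0 (t : R) : (0 <= (t ^+ 2)%:E)%E by rewrite lee_fin sqr_ge0.
have mf i : measurable_fun [set: T] (fun w => (noise eps w i ^+ 2)%:E).
  by apply/measurable_EFinP; apply: measurable_funX.
have nn0 : 0 <= n%:R^-1 :> R by rewrite invr_ge0.
transitivity (\int[P]_w (\sum_(i < N) n%:R^-1%:E * (noise eps w i ^+ 2)%:E +
   \sum_(N <= i <oo) (beta i ^+ 2)%:E))%E.
  apply: eq_integral => w _; rewrite /sq_norm (nneseries_split 0 N)// add0n.
  congr (_ + _)%E.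
    rewrite big_mkord; apply: eq_bigr => i _.
    rewrite /beta_hat cutoffE// ltn_ord /observation /noise addrC addKr.
    by rewrite exprMn exprVn sqr_sqrtr// EFinM.
  apply/congr_lim/funext => k; apply: eq_big_nat => i /andP[Ni _].
  by rewrite /beta_hat cutoffE// ltnNge Ni sub0r sqrrN.
rewrite ge0_integralD//.
- rewrite integral_cst// [X in (_ + _ * X)%E](_ : _ = 1%E); last exact: probability_setT.
  rewrite mule1; congr (_ + _)%E.
  rewrite ge0_integral_sum//; last 2 first.
  + by move=> i; exact: measurable_funeM.
  + by move=> i w _; rewrite mule_ge0.
  under eq_bigr do rewrite ge0_integralZl// second_moment_noise.
  have vfin : v \is a fin_num.
    rewrite ge0_fin_numE; first exact: std_normal_second_moment.
    by apply: integral_ge0 => x _; exact: sq0.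
  rewrite -(fineK vfin); under eq_bigr do rewrite -EFinM.
  by rewrite sumEFin sumr_const card_ord -EFinM -mulrnAl -(mulr_natl n%:R^-1).
- by move=> w _; apply: sume_ge0 => i _; rewrite mule_ge0.
- by apply: emeasurable_sum => i; exact: measurable_funeM.
- by move=> w _; apply: nneseries_ge0.
Qed.

Lemma max_risk_beta_hat_le : exists2 C : R, 0 < C & forall n, (0 < n)%N ->
  (max_risk eps alpha n (@beta_hat R alpha n) <= (C * rate alpha n)%:E)%E.
Proof.
have v0 : (0 <= v)%E by apply: integral_ge0 => x _; rewrite lee_fin sqr_ge0.
have vfin : v \is a fin_num.
  by rewrite ge0_fin_numE//; exact: std_normal_second_moment.
have fv0 : 0 <= fine v by exact: fine_ge0.
have r0 : 0 < 2 * alpha - 1 by move: alpha_gt; lra.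
exists (fine v + (2 * alpha - 1)^-1 * 2 `^ (2 * alpha - 1)).
  by rewrite ltr_wpDl// mulr_gt0 ?invr_gt0// powR_gt0.
move=> n n0; apply: ge_ereal_sup => _ [beta Bb <-].
have [N0 _ _] := cutoff_bounds alpha_gt n0.
rewrite risk_beta_hatE// mulrDl EFinD; apply: leeD.
  rewrite -(fineK vfin) -EFinM lee_fin mulrC ler_wpM2l//.
  exact: cutoff_div_le.
apply: (le_trans (B_alpha_tail alpha_gt Bb N0)).
rewrite lee_fin -mulrA ler_pM2l ?invr_gt0//.
exact: cutoff_powR_le.
Qed.

End UpperBound.

(** * Lower bound on the minimax risk *)

Section Cube.
Variables (R : realType) (N : nat).
Implicit Types (s : {ffun 'I_N -> bool}) (i : 'I_N).

Definition toggle i s : {ffun 'I_N -> bool} :=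
  [ffun j => if j == i then ~~ s j else s j].

Lemma toggleK i : involutive (toggle i).
Proof. by move=> s; apply/ffunP => j; rewrite !ffunE; case: eqP; rewrite ?negbK. Qed.

(** The averaging step of Assouad's lemma: toggling the i-th sign permutes the
    cube, so the mean of e s i over the cube is at least c / 2 for each i. *)
Lemma cube_average (e : {ffun 'I_N -> bool} -> 'I_N -> R) (c m : R) :
  (forall s i, c <= e s i + e (toggle i s) i) ->
  (forall s, \sum_i e s i <= m) ->
  N%:R * c <= 2 * m.
Proof.
move=> ec em.
pose K : R := #|{ffun 'I_N -> bool}|%:R.
have K0 : 0 < K by rewrite ltr0n; apply/card_gt0P; exists [ffun=> true].
rewrite -(ler_pM2l K0) (mulrCA _ 2).
have le1 : \sum_s \sum_i e s i <= K * m.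
  apply: (@le_trans _ _ (\sum_(s : {ffun 'I_N -> bool}) m)); first by apply: ler_sum.
  by rewrite sumr_const mulr_natl.
apply: (@le_trans _ _ (2 * \sum_s \sum_i e s i)); last by rewrite ler_pM2l.
rewrite exchange_big mulr_sumr.
apply: (@le_trans _ _ (\sum_(i < N) K * c)).
  by rewrite sumr_const card_ord -[leRHS]mulr_natl mulrCA.
apply: ler_sum => i _.
have toggle_sum : \sum_s e (toggle i s) i = \sum_s e s i.
  by rewrite [RHS](reindex_inj (can_inj (toggleK i))).
rewrite mulr_natl mulr2n -{2}toggle_sum -big_split/=.
rewrite mulr_natl -sumr_const.
by apply: ler_sum.
Qed.

End Cube.

Section TwoPoint.
Variables (R : realType) (L : probability (seq_space R) R).
Hypothesis gL : gaussian_product L.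
Local Notation N01 := (@normal_prob R 0 1).

Definition affine (delta : R) (beta : nat -> R) (x : seq_space R) : seq_space R :=
  fun i => beta i + delta * x i.

Lemma measurable_affine delta beta :
  measurable_fun [set: seq_space R] (affine delta beta).
Proof.
apply: measurable_seq_spaceP => i; rewrite /affine.
by apply: measurable_funD => //; apply: measurable_funM => //; exact: measurable_coord.
Qed.

Lemma measurable_preimage_affine delta beta D :
  measurable D -> measurable (affine delta beta @^-1` D).
Proof.
by move=> mD; rewrite -[X in measurable X]setTI; exact: measurable_affine.
Qed.

Lemma measurable_update_section i x D : measurable D ->
  measurable [set t : R | D (update i t x)].
Proof.
move=> mD.
have mu : measurable_fun [set: measurableTypeR R] (fun t : measurableTypeR R => update i t x).
  apply: measurable_seq_spaceP => j; rewrite /update; case: (j == i) => //.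
by rewrite -[X in measurable X]setTI; exact: mu.
Qed.

Lemma measurable_resample i D : measurable D ->
  measurable_fun [set: seq_space R] (fun x => N01 [set t | D (update i t x)]).
Proof.
move=> mD.
have mD' : measurable ((fun z : seq_space R * measurableTypeR R => update i z.2 z.1) @^-1` D).
  by rewrite -[X in measurable X]setTI; exact: measurable_update.
have := measurable_fun_xsection N01 mD'.
congr measurable_fun; apply/funext => x /=; congr (N01 _).
by apply/seteqP; split => t; rewrite /xsection/= inE.
Qed.

(** Conditionally on the coordinates other than i, the two observations are
    delta (1 + t) and delta (-1 + t) in place i and agree elsewhere, so
    that D and its complement are cut along the same line, by one set S and its
    complement. *)
Lemma two_point_testing c delta i beta beta' (D : set (seq_space R)) : 0 <= c ->
  (forall A : set R, measurable A ->
    c%:E <= N01 [set t | A (1 + t)%R] + N01 [set t | ~ A (- 1 + t)%R])%E ->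
  measurable D ->
  beta i = delta -> beta' i = - delta ->
  (forall j, j != i -> beta j = beta' j) ->
  (c%:E <= L (affine delta beta @^-1` D) + L (affine delta beta' @^-1` ~` D))%E.
Proof.
move=> c0 cN mD bi b'i bb'.
have mDb := measurable_preimage_affine delta beta mD.
have mDb' := measurable_preimage_affine delta beta' (measurableC mD).
rewrite (resample gL i mDb) (resample gL i mDb').
rewrite -ge0_integralD//; last 2 first.
- exact: measurable_resample.
- exact: measurable_resample.
have -> : c%:E = (\int[L]_x cst c%:E x)%E.
  by rewrite integral_cst// [X in (_ * X)%E](_ : _ = 1%E) ?mule1//; exact: probability_setT.
apply: ge0_le_integral => //.
- by apply: emeasurable_funD; exact: measurable_resample.
- move=> x _.
  pose S := [set s : R | D (update i (delta * s) (affine delta beta x))].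
  have mS : measurable S.
    have mm : measurable_fun [set: R] ( *%R delta) by exact: mulrl_measurable.
    have -> : S = *%R delta @^-1` [set t | D (update i t (affine delta beta x))].
      by [].
    rewrite -[X in measurable X]setTI; apply: mm => //.
    exact: measurable_update_section.
  have E1 t : affine delta beta (update i t x) =
              update i (delta * (1 + t)) (affine delta beta x).
    apply/funext => j; rewrite /affine /update; case: eqP => // ->.
    by rewrite bi mulrDr mulr1.
  have E2 t : affine delta beta' (update i t x) =
              update i (delta * (- 1 + t)) (affine delta beta x).
    apply/funext => j; rewrite /affine /update; case: eqP => [->|/eqP ji].
      by rewrite b'i mulrDr mulrN1.
    by rewrite bb'.
  rewrite (_ : [set t | _] = [set t | S (1 + t)]); last first.
    by apply/seteqP; split => t /=; rewrite /S/= E1.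
  rewrite (_ : [set t | (affine delta beta' @^-1` ~` D) _] =
               [set t | ~ S (- 1 + t)]); last first.
    by apply/seteqP; split => t /=; rewrite /S/= E2.
  exact: cN.
Qed.

End TwoPoint.

Section LowerBound.
Context (R : realType) (d : measure_display) (T : measurableType d).
Variables (P : probability T R) (eps : nat -> {RV P >-> R}).
Hypothesis Heps : iid_std_normal eps.
Variable alpha : R.
Hypothesis alpha_gt : 1 / 2 < alpha.

(** Vertices of the cube of half-side n^(-1/2) in the first N coordinates. *)
Definition vertex (n N : nat) (s : {ffun 'I_N -> bool}) : nat -> R :=
  fun k => if insub k is Some i then (if s i then 1 else -1) / Num.sqrt n%:R
           else 0.

Lemma vertexE n N (s : {ffun 'I_N -> bool}) (i : 'I_N) :
  vertex n s i = (if s i then 1 else -1) / Num.sqrt n%:R.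
Proof. by rewrite /vertex valK. Qed.

Lemma vertex_toggle n N (s : {ffun 'I_N -> bool}) (i : 'I_N) j :
  j != i :> nat -> vertex n (toggle i s) j = vertex n s j.
Proof.
move=> ji; rewrite /vertex; case: insubP => // k _ kj.
by rewrite ffunE; case: eqP => // ki; move: ji; rewrite -kj ki eqxx.
Qed.

(** The cutoff is the last index at which i^(-alpha) is still at least n^(-1/2). *)
Lemma vertex_B_alpha n (s : {ffun 'I_(cutoff alpha n) -> bool}) :
  (0 < n)%N -> B_alpha alpha (vertex n s).
Proof.
move=> n0 k; rewrite /vertex; case: insubP => [i ilt _|_]; last first.
  by rewrite normr0 powR_ge0.
have sn : 0 < Num.sqrt n%:R :> R by rewrite sqrtr_gt0 ltr0n.
rewrite normrM normfV (gtr0_norm sn) (_ : `|_| = 1); last first.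
  by case: (s i); rewrite ?normrN1 ?normr1.
rewrite mul1r powRN lef_pV2 ?posrE ?powR_gt0//.
by rewrite cutoffE.
Qed.

Lemma observationE n beta w :
  observation eps n beta w = affine (Num.sqrt n%:R)^-1 beta (noise eps w).
Proof. by []. Qed.

(** Reading the sign of b x i as a guess for the sign of beta_i, each wrong guess
    costs at least the squared half-side 1/n, and by two_point_testing and
    cube_average some vertex has at least N c / 2 expected wrong guesses. *)
Lemma max_risk_ge (c : R) : 0 <= c ->
  (forall A : set R, measurable A ->
    c%:E <= normal_prob 0 1 [set t | A (1 + t)%R] +
            normal_prob 0 1 [set t | ~ A (- 1 + t)%R])%E ->
  forall n b, (0 < n)%N -> estimator b ->
  ((c / 4 * rate alpha n)%:E <= max_risk eps alpha n b)%E.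
Proof.
move=> c0 cN n b n0 [mb b2].
set N := cutoff alpha n; set delta := (Num.sqrt n%:R)^-1 : R.
have delta0 : 0 < delta by rewrite invr_gt0 sqrtr_gt0 ltr0n.
have mbi i : measurable_fun [set: seq_space R] (fun x => b x i).
  exact: (measurableT_comp (measurable_coord i) mb).
pose D i : set (seq_space R) := [set x | b x i <= 0].
have mD i : measurable (D i).
  rewrite (_ : D i = (fun x => b x i) @^-1` `]-oo, 0]).
    by rewrite -[X in measurable X]setTI; exact: mbi.
  by apply/seteqP; split => x /=; rewrite in_itv.
pose wrong (s : {ffun 'I_N -> bool}) (i : 'I_N) : set (seq_space R) :=
  affine delta (vertex n s) @^-1` (if s i then D i else ~` D i).
have mwrong s i : measurable (wrong s i).
  apply: measurable_preimage_affine; case: (s i) => //; exact: measurableC.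
pose L := noise_law eps; have gL : gaussian_product L := gaussian_noise Heps.
pose e s i : R := fine (L (wrong s i)).
have eE s i : (e s i)%:E = L (wrong s i) by rewrite fineK// fin_num_measure.
have testing s i : c <= e s i + e (toggle i s) i.
  (* The inequality is symmetric under toggle, so s i may be taken positive. *)
  wlog si : s / s i = true.
    move=> W; case si : (s i); first exact: W.
    have := W (toggle i s); rewrite toggleK ffunE eqxx si addrC; exact.
  rewrite -lee_fin EFinD !eE /wrong ffunE eqxx si.
  apply: (@two_point_testing R L gL c delta i (vertex n s) (vertex n (toggle i s)) (D i) c0 cN (mD i)).
  - by rewrite vertexE si mul1r.
  - by rewrite vertexE ffunE eqxx si mulN1r.
  - by move=> j ji; rewrite vertex_toggle.
have risk_ge s :
  ((delta ^+ 2 * \sum_i e s i)%:E <= risk eps n b (vertex n s))%E.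
  have mw i : measurable (noise eps @^-1` wrong s i).
    exact: measurable_preimage_noise.
  have -> : ((delta ^+ 2 * \sum_i e s i)%:E =
      \int[P]_w \sum_(i < N)
        ((delta ^+ 2)%:E * (\1_(noise eps @^-1` wrong s i) w)%:E))%E.
    rewrite ge0_integral_sum//; last 2 first.
    - by move=> i; apply: measurable_funeM; apply/measurable_EFinP; exact: measurable_indic.
    - by move=> i w _; rewrite mule_ge0// lee_fin ?sqr_ge0.
    rewrite mulr_sumr -sumEFin; apply: eq_bigr => i _.
    rewrite ge0_integralZl//.
    - by rewrite integral_indic// setIT EFinM eE.
    - by apply/measurable_EFinP; exact: measurable_indic.
    - by rewrite lee_fin sqr_ge0.
  apply: ge0_le_integral => //.
  - by move=> w _; apply: sume_ge0 => i _; rewrite mule_ge0// lee_fin ?sqr_ge0.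
  - apply: emeasurable_sum => i; apply: measurable_funeM; apply/measurable_EFinP.
    exact: measurable_indic.
  - apply: (@ge0_emeasurable_sum _ _ _ setT
      (fun i w => ((b (observation eps n (vertex n s) w) i - vertex n s i) ^+ 2)%:E) xpredT).
      by move=> i w _ _; rewrite lee_fin sqr_ge0.
    move=> i _; apply/measurable_EFinP; apply: measurable_funX; apply: measurable_funB => //.
    exact: (measurableT_comp (mbi i) (measurable_observation _ _ _)).
  - move=> w _.
    apply: (@le_trans _ _ (\sum_(0 <= i < N)
      ((b (observation eps n (vertex n s) w) i - vertex n s i) ^+ 2)%:E)%E); last first.
      by apply: nneseries_lim_ge => i _ _; rewrite lee_fin sqr_ge0.
    rewrite big_mkord; apply: lee_sum => i _.
    rewrite -EFinM lee_fin indicE; case: (boolP (_ \in _)) => /= [|_]; last first.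
      by rewrite mulr0 sqr_ge0.
    rewrite inE mulr1 vertexE observationE /wrong/=.
    set y := b _ _; rewrite -/delta.
    case: (s i); rewrite /D/= -/y.
      move=> y0; rewrite mul1r -[leRHS]sqrrN opprB ler_sqr ?nnegrE; lra.
    move=> /negP; rewrite -ltNge => y0.
    by rewrite mulN1r opprK ler_sqr ?nnegrE; lra.
set M := max_risk _ _ _ _.
have M_ge s : ((delta ^+ 2 * \sum_i e s i)%:E <= M)%E.
  apply: (le_trans (risk_ge s)); apply: ereal_sup_ubound.
  by exists (vertex n s) => //; exact: vertex_B_alpha.
case: M M_ge => [m||] M_ge; last 2 first.
- by rewrite leey.
- by have := M_ge [ffun=> true].
have := @cube_average R N e c (delta ^- 2 * m) testing.
have d2 : delta ^+ 2 = n%:R^-1 by rewrite exprVn sqr_sqrtr.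
rewrite d2 invrK => /(_ _)/wrap[s|h].
  by have := M_ge s; rewrite lee_fin d2 ler_pdivrMl ?ltr0n.
rewrite lee_fin.
have := cutoff_div_ge alpha_gt n0; rewrite -/N => hr.
apply: (@le_trans _ _ (c / 2 * (N%:R / n%:R))).
  have := ler_wpM2l c0 hr; move: (N%:R / n%:R) (rate alpha n) => q r; lra.
rewrite mulrA ler_pdivrMr ?ltr0n//.
by lra.
Qed.

End LowerBound.

(** * Root-n consistency and the minimax rate *)

Theorem proposition4p1 (R : realType) (d : measure_display)
    (T : measurableType d) (P : probability T R)
    (eps : nat -> {RV P >-> R}) (Heps : iid_std_normal eps)
    (alpha : R) (Halpha : 1 / 2 < alpha) :
  (forall (g beta : nat -> R), ell2 g -> B_alpha alpha beta ->
     [/\ cvgn (series (fun i => g i * beta i)),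
         forall n, (0 < n)%N ->
           {ae P, forall w,
              cvgn (series (fun i => g i * observation eps n beta w i))},
         measurable_fun [set: seq_space R] (linear_form g : seq_space R -> R) &
         sqrtn_consistent P
           (fun n w => linear_form g (observation eps n beta w))
           (linear_form g beta)]) /\
  (let rate := fun n : nat => n%:R `^ (- ((2 * alpha - 1) / (2 * alpha))) in
   [/\ forall n, estimator (@beta_hat R alpha n),
       same_order (minimax_risk eps alpha) rate &
       same_order (fun n => max_risk eps alpha n (@beta_hat R alpha n)) rate]).
Proof.
split=> [g beta g2 Bb|].
  have b2 := B_alpha_ell2 Halpha Bb.
  split.
  - exact: ell2_cvg_inner.
  - by move=> n _; exact: observation_series_ae_cvg.
  - exact: measurable_linear_form.
  - exact: linear_form_sqrtn_consistent.
have hat_est := beta_hat_estimator Halpha.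
have [C C0 upper] := max_risk_beta_hat_le Heps Halpha.
have [c c0 testing] := std_normal_testing R.
have lower := max_risk_ge Heps Halpha (ltW c0) testing.
split => //; exists (c / 4), C; split; rewrite ?divr_gt0//; exists 1%N => // n n0.
  split.
    by apply: le_ereal_inf_tmp => _ [b best <-]; exact: lower.
  apply: le_trans (upper n n0); apply: ereal_inf_lbound.
  by exists (@beta_hat R alpha n).
split; first exact: lower.
exact: upper.
Qed.
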